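(* Let $R\ge1$, let $C\subseteq\mathbb{R}^2$ be a compact convex $R$-fat set, and let $S$ be the family of convex $2R$-fat subsets of $\mathbb{R}^2$. Then $\mathrm{PropEF}(C,2,S)=1/2$.
   Context: For $R\ge1$, a planar piece (Borel subset of $\mathbb{R}^2$) is $R$-fat if it contains a square $B^-$ and is contained in a square $B^+$ parallel to $B^-$ with $\mathrm{len}(B^+)/\mathrm{len}(B^-)\le R$ (len = side length). A value measure on $C$ is $V(X)=\int_X v$ with $v$ non-negative, bounded, integrable on $C$, $V(C)<\infty$; $V^S(X):=\sup\{V(s):s\in S,s\subseteq X\}$. For $n$ agents with value measures $V_1,\dots,V_n$, an $S$-allocation is $(X_1,\dots,X_n)$ with $X_i\in S$ pairwise disjoint and $\bigcup_i X_i\subseteq C$; it is envy-free if $V_i^S(X_i)\ge V_i^S(X_j)$ for all $i,j$. $\mathrm{PropEF}(C,n,S):=\inf_{V_1,\dots,V_n}\sup_X\min_i V_i(X_i)/V_i(C)$, the infimum over all $n$-tuples of value measures on $C$ and the supremum over envy-free $S$-allocations. *)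

(* Defs.v *)
(* Points of the plane are pairs in R * R,
   Borel sets = measurable sets of the product sigma-algebra (which is the
   Borel sigma-algebra of R^2), area = product Lebesgue measure. *)
From HB Require Import structures.
From mathcomp Require Import all_boot all_order all_algebra.
From mathcomp Require Import all_classical all_reals all_analysis.
Set Implicit Arguments. Unset Strict Implicit. Unset Printing Implicit Defensive.
Import Order.TTheory GRing.Theory Num.Theory.
Local Open Scope classical_set_scope.
Local Open Scope ring_scope.

Section Defs.
Variable R : realType.

Local Notation pt := (R * R)%type.

Definition leb2 := ((@lebesgue_measure R) \x (@lebesgue_measure R))%E.

(* closed square with center c, side direction (p,q) (a unit vector, the
   other side direction being (-q,p)) and side length l *)
Definition square (c : pt) (p q l : R) : set pt :=
  [set x | `|(x.1 - c.1) * p + (x.2 - c.2) * q| <= l / 2 /\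
           `|(x.2 - c.2) * p - (x.1 - c.1) * q| <= l / 2].

Definition fat (Rf : R) (X : set pt) : Prop :=
  exists (c1 c2 : pt) (p q l1 l2 : R),
    [/\ p ^+ 2 + q ^+ 2 = 1, 0 < l1 /\ 0 < l2,
        square c1 p q l1 `<=` X, X `<=` square c2 p q l2 & l2 / l1 <= Rf].

Definition convex_set2 (X : set pt) : Prop :=
  forall x y t, X x -> X y -> 0 <= t <= 1 ->
    X ((1 - t) * x.1 + t * y.1, (1 - t) * x.2 + t * y.2).

Definition piece (X : set pt) : Prop := measurable X.

Definition Vm (v : pt -> R) (X : set pt) : \bar R :=
  (\int[leb2]_(x in X) (v x)%:E)%E.

Definition value_density (C : set pt) (v : pt -> R) : Prop :=
  [/\ forall x, C x -> 0 <= v x,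
      (exists M : R, forall x, C x -> v x <= M),
      leb2.-integrable C (fun x => (v x)%:E) &
      (0 < Vm v C)%E].

Definition VS (S : set (set pt)) (v : pt -> R) (X : set pt) : \bar R :=
  ereal_sup [set Vm v s | s in [set s | S s /\ s `<=` X]].

Definition allocation (C : set pt) (n : nat) (S : set (set pt))
    (X : 'I_n -> set pt) : Prop :=
  [/\ forall i, S (X i),
      (forall i j, i != j -> X i `&` X j = set0) &
      (forall i, X i `<=` C)].

Definition envy_free (n : nat) (S : set (set pt)) (v : 'I_n -> pt -> R)
    (X : 'I_n -> set pt) : Prop :=
  forall i j, (VS S (v i) (X j) <= VS S (v i) (X i))%E.

Definition prop_value (C : set pt) (n : nat) (v : 'I_n -> pt -> R)
    (X : 'I_n -> set pt) : \bar R :=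
  \big[Order.min/+oo%E]_(i < n) ((fine (Vm (v i) (X i)) / fine (Vm (v i) C))%:E).

Definition PropEF (C : set pt) (n : nat) (S : set (set pt)) : \bar R :=
  ereal_inf [set ereal_sup [set prop_value C v X | X in
                 [set X | allocation C S X /\ envy_free S v X]]
            | v in [set v : 'I_n -> pt -> R | forall i, value_density C (v i)]].

End Defs.

(* Main.v *)
(** Every line through the centre of the inner square B^- of C leaves a quadrant
   of B^- on each side, so the two parts of C it cuts off contain a square of
   half the side of B^- and are contained in B^+: they are 2R-fat.  Rotating the
   line until it halves C for the first agent and letting the second one choose
   would settle the matter, except that the two pieces must be disjoint while
   the quadrants are closed and meet in the centre.  Hence each part is first
   contracted by a factor 1 - e towards a point in its interior, which keeps the
   fatness; half-turn antisymmetry and the intermediate value theorem still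
   equalise the two pieces exactly for the first agent, and the value that is
   lost tends to 0 with e, uniformly in the direction of the line.  Instead of
   contracting C itself we intersect it with the contracted half-plane and outer
   square, so that the value only depends on moving straight edges.  The bound
   1/2 is optimal for two agents with the same density. *)
Require Import Defs.
From HB Require Import structures.
From mathcomp Require Import all_boot all_order all_algebra.
From mathcomp Require Import all_classical all_reals all_analysis.
From mathcomp Require Import measurable_realfun ring lra.
Import Order.TTheory GRing.Theory Num.Theory numFieldNormedType.Exports.
Local Open Scope classical_set_scope.
Local Open Scope ring_scope.

(** * Lebesgue measure in the plane: the area of a strip inside a box *)

Section PlaneMeasure.
Set Implicit Arguments. Unset Strict Implicit. Unset Printing Implicit Defensive.
Context {R : realType}.
Local Notation mR := (measurableTypeR R).
Local Notation mu := (@lebesgue_measure R).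

Lemma lebesgue_segment (a b : R) : a <= b -> mu `[a, b]%classic = (b - a)%:E.
Proof.
rewrite lebesgue_measure_itv/= lte_fin le_eqVlt => /orP[/eqP->|->//].
by rewrite ltxx subrr.
Qed.

(** Last step of Cavalieri's principle: [phi] will be the length of the sections of a planar set,
    and [2 * w] the length of an interval of radius [w]. *)
Lemma integral_le_rectangle (phi : mR -> \bar R) (a b w : R) :
  measurable_fun setT phi -> a <= b ->
  (forall x, 0 <= phi x)%E -> (forall x, phi x <= (2 * w)%:E)%E ->
  (forall x, ~~ (a <= x <= b) -> phi x = 0%E) ->
  (\int[mu]_x phi x <= ((b - a) * (2 * w))%:E)%E.
Proof.
move=> mphi ab phi0 phiw phiab.
have mB : measurable (`[a, b] : set mR) by exact: measurable_itv.
have -> : phi = phi \_ `[a, b].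
  apply/funext => x; rewrite /patch; case: ifPn => // /negP xab.
  by apply: phiab; apply/negP => h; apply: xab; rewrite inE/= in_itv/=.
rewrite -integral_mkcond.
apply: (@le_trans _ _ (\int[mu]_(x in `[a, b]) (cst (2 * w)%:E) x)%E).
  apply: ge0_le_integral => //.
  exact: measurable_funS mphi.
by rewrite integral_cst// [X in (_ * X)%E](lebesgue_segment ab) muleC -EFinM.
Qed.

Lemma lebesgue_measure_le_segment (A : set mR) (y w : R) :
  measurable A -> 0 <= w -> (forall t, A t -> `|t - y| <= w) ->
  (mu A <= (2 * w)%:E)%E.
Proof.
move=> mA w0 Aw; apply: (@le_trans _ _ (mu `[y - w, y + w]%classic)).
  apply: le_measure; rewrite ?inE//.
  by move=> t /Aw; rewrite /= in_itv/= ler_distl.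
rewrite [leLHS]lebesgue_segment ?lee_fin; lra.
Qed.

Lemma leb2_le_xsection (A : set (mR * mR)) (a b w : R) :
  measurable A -> a <= b -> 0 <= w ->
  (forall x, A x -> a <= x.1 <= b) ->
  (forall s, exists y, forall t, A (s, t) -> `|t - y| <= w) ->
  (leb2 A <= ((b - a) * (2 * w))%:E)%E.
Proof.
move=> mA ab w0 Aab Aw; apply: integral_le_rectangle => //.
- exact: measurable_fun_xsection.
- move=> x; have [y Hy] := Aw x.
  apply: (@lebesgue_measure_le_segment _ y) => //; first exact: measurable_xsection.
  by move=> t; rewrite /xsection/= inE => /Hy.
move=> x /negP xab /=; rewrite (_ : xsection A x = set0) ?measure0//.
by apply/seteqP; split=> // t; rewrite /xsection/= inE => /Aab.
Qed.

Lemma leb2_le_ysection (A : set (mR * mR)) (a b w : R) :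
  measurable A -> a <= b -> 0 <= w ->
  (forall x, A x -> a <= x.2 <= b) ->
  (forall s, exists y, forall t, A (t, s) -> `|t - y| <= w) ->
  (leb2 A <= ((b - a) * (2 * w))%:E)%E.
Proof.
move=> mA ab w0 Aab Aw; 
(* The product measure integrates the x-sections by definition; uniqueness of the product measure
   allows the y-sections instead. *)
have -> : leb2 A = (\int[mu]_y mu (ysection A y))%E.
  exact: (product_measure_unique (m' := (mu \x^ mu)%E) (product_measure2E mu mu)).
apply: integral_le_rectangle => //.
- exact: measurable_fun_ysection.
- move=> x; have [y Hy] := Aw x.
  apply: (@lebesgue_measure_le_segment _ y) => //; first exact: measurable_ysection.
  by move=> t; rewrite /ysection/= inE => /Hy.
move=> x /negP xab /=; rewrite (_ : ysection A x = set0) ?measure0//.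
by apply/seteqP; split=> // t; rewrite /ysection/= inE => /Aab.
Qed.

(* The lower bound on the gradient makes the strip bound below uniform. *)
Definition affine2 (f : R * R -> R) :=
  exists al be ga, 2^-1 <= al ^+ 2 + be ^+ 2 /\
    forall x, f x = al * x.1 + be * x.2 + ga.

Definition box2 (k : R * R) (K : R) : set (R * R) :=
  [set x | `|x.1 - k.1| <= K /\ `|x.2 - k.2| <= K].

Lemma affine2_measurable f : affine2 f -> measurable_fun [set: mR * mR] f.
Proof.
case=> al [be [ga [_ fE]]].
rewrite (_ : f = fun x => al * x.1 + be * x.2 + ga); last exact/funext.
apply: measurable_funD; last exact: measurable_cst.
by apply: measurable_funD; apply: measurable_funM => //; exact: measurable_cst.
Qed.

Lemma affine2_convex f : affine2 f -> convex_set2 [set x | 0 <= f x].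
Proof.
case=> al [be [ga [_ fE]]] x y t /= + + /andP[t0 t1]; rewrite !fE/= => x0 y0.
have -> : al * ((1 - t) * x.1 + t * y.1) + be * ((1 - t) * x.2 + t * y.2) + ga
  = (1 - t) * (al * x.1 + be * x.2 + ga) + t * (al * y.1 + be * y.2 + ga) by ring.
by rewrite addr_ge0// mulr_ge0// subr_ge0.
Qed.

Lemma piece_halfplane f : affine2 f -> piece [set x | 0 <= f x].
Proof.
move=> /affine2_measurable mf; rewrite /piece.
have -> : [set x | 0 <= f x] = f @^-1` `[0, +oo[.
  by apply/seteqP; split=> x /=; rewrite in_itv/= andbT.
rewrite -[_ @^-1` _]setTI; apply: (mf measurableT _ (measurable_itv _)).
Qed.

Lemma piece_strip f w : affine2 f -> piece [set x | `|f x| <= w].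
Proof.
move=> /affine2_measurable mf; rewrite /piece.
have -> : [set x | `|f x| <= w] = f @^-1` `[- w, w].
  by apply/seteqP; split=> x /=; rewrite in_itv/= ler_norml.
rewrite -[_ @^-1` _]setTI; apply: (mf measurableT _ (measurable_itv _)).
Qed.

Lemma box2E k K : box2 k K =
  (`[k.1 - K, k.1 + K] `*` `[k.2 - K, k.2 + K])%classic.
Proof.
apply/seteqP; split=> x /=; rewrite /box2/= !in_itv/= !ler_distl; first by case=> -> ->.
by case=> -> ->.
Qed.

Lemma piece_box2 k K : piece (box2 k K).
Proof.
by rewrite box2E /piece; apply: measurableX; exact: measurable_itv.
Qed.

Lemma leb2_box2 k K : 0 < K -> leb2 (box2 k K) = (4 * K ^+ 2)%:E.
Proof.
move=> K0; rewrite box2E /leb2 product_measure1E; [|exact: measurable_itv..].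
rewrite [X in (X * _)%E]lebesgue_segment ?[X in (_ * X)%E]lebesgue_segment; [|lra..].
rewrite -EFinM; congr _%:E; ring.
Qed.

(** One coefficient of [f] has absolute value at least 1/2, since otherwise their squares would sum
    to less than 1/2. Along that coordinate the sections of the strip lie in intervals of radius
    [2 * w], and the other coordinate ranges over a length [2 * K]. *)
Lemma leb2_strip f k (K w : R) : affine2 f -> 0 <= K -> 0 <= w ->
  (leb2 (box2 k K `&` [set x | (`|f x| <= w)%R]) <= (8 * K * w)%:E)%E.
Proof.
move=> af K0 w0; have mA : piece (box2 k K `&` [set x | `|f x| <= w]).
  by apply: measurableI; [exact: piece_box2|exact: piece_strip].
have key (a y c : R) : 2^-1 <= `|a| -> `|a * y + c| <= w -> `|y + c / a| <= 2 * w.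
  move=> ha; have a0 : a != 0 by rewrite -normr_gt0; lra.
  have -> : a * y + c = a * (y + c / a) by field.
  rewrite normrM => h; have := normr_ge0 (y + c / a); nra.
case: (af) => al [be [ga [ab fE]]].
have [hb|hb] := leP 2^-1 `|be|.
  apply: (@le_trans _ _ (((k.1 + K) - (k.1 - K)) * (2 * (2 * w)))%:E); last first.
    rewrite lee_fin; lra.
  apply: leb2_le_xsection => //; [lra|lra| |].
    by move=> x [[]]; rewrite ler_distl.
  move=> s; exists (- ((al * s + ga) / be)) => t [_] /=.
  rewrite fE/= opprK => h; apply: key => //; move: h.
  by rewrite (_ : al * s + be * t + ga = be * t + (al * s + ga)); last ring.
have ha : 2^-1 <= `|al|.
  rewrite leNgt; apply/negP => ha.
  have : `|al| ^+ 2 + `|be| ^+ 2 < 2^-1 by have := normr_ge0 al; have := normr_ge0 be; nra.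
  by rewrite !real_normK ?num_real// ltNge ab.
apply: (@le_trans _ _ (((k.2 + K) - (k.2 - K)) * (2 * (2 * w)))%:E); last first.
  rewrite lee_fin; lra.
apply: leb2_le_ysection => //; [lra|lra| |].
  by move=> x [[]]; rewrite !ler_distl.
move=> t; exists (- ((be * t + ga) / al)) => s [_] /=.
rewrite fE/= opprK => h; apply: key => //; move: h.
by rewrite (_ : al * s + be * t + ga = al * s + (be * t + ga)); last ring.
Qed.

End PlaneMeasure.

(** * Intersections of half-planes, and how their value varies with the edges *)

Section Polygon.
Set Implicit Arguments. Unset Strict Implicit. Unset Printing Implicit Defensive.
Context {R : realType}.
Implicit Types (X Y D : set (R * R)) (F G : nat -> R * R -> R).

Definition polygon n F : set (R * R) := [set x | forall i, (i < n)%N -> 0 <= F i x].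

Lemma polygon0 F : polygon 0 F = setT.
Proof. by apply/seteqP; split. Qed.

Lemma polygonS n F : polygon n.+1 F = polygon n F `&` [set x | 0 <= F n x].
Proof.
apply/seteqP; split=> x /=.
  by move=> h; split=> [i ni|]; apply: h => //; exact: ltnW.
by move=> [h1 h2] i; rewrite ltnS leq_eqVlt => /orP[/eqP->//|]; exact: h1.
Qed.

Lemma piece_polygon n F : (forall i, affine2 (F i)) -> piece (polygon n F).
Proof.
move=> aF; rewrite /piece; elim: n => [|n IH]; first by rewrite polygon0.
by rewrite polygonS; apply: measurableI => //; exact: piece_halfplane.
Qed.

Lemma convex_set2I X Y : convex_set2 X -> convex_set2 Y -> convex_set2 (X `&` Y).
Proof. by move=> cX cY x y t [Xx Yx] [Xy Yy] t01; split; [exact: cX|exact: cY]. Qed.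

Lemma convex_polygon n F : (forall i, affine2 (F i)) -> convex_set2 (polygon n F).
Proof.
move=> aF x y t hx hy t01 i ni.
by apply: (affine2_convex (aF i)) => //; [exact: hx|exact: hy].
Qed.

Lemma fin_num_Vm C v X : value_density C v -> piece C -> piece X -> X `<=` C ->
  Vm v X \is a fin_num.
Proof.
move=> [_ _ iv _] mC mX XC; apply: integrable_fin_num => //.
exact: integrableS iv.
Qed.

Lemma Vm_measurable C v X : value_density C v -> piece C -> X `<=` C ->
  measurable_fun (X : set (measurableTypeR R * measurableTypeR R)) (fun x => (v x)%:E).
Proof. by move=> [_ _ iv _] mC XC; apply: measurable_funS (measurable_int _ iv). Qed.

Lemma le_Vm C v X Y : value_density C v -> piece C -> piece X -> piece Y ->
  X `<=` Y -> Y `<=` C -> (Vm v X <= Vm v Y)%E.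
Proof.
move=> vC mC mX mY XY YC; apply: ge0_subset_integral => //.
  exact: Vm_measurable vC _ _.
by case: vC => v0 _ _ _ x Yx; rewrite lee_fin v0//; exact: YC.
Qed.

Lemma Vm_setU C v X Y : value_density C v -> piece C -> piece X -> piece Y ->
  X `<=` C -> Y `<=` C -> X `&` Y = set0 ->
  Vm v (X `|` Y) = (Vm v X + Vm v Y)%E.
Proof.
move=> vC mC mX mY XC YC XY0; have XYC : X `|` Y `<=` C by rewrite subUset.
apply: ge0_integral_setU => //.
- exact: Vm_measurable vC _ _.
- by case: vC => v0 _ _ _ x /XYC Cx; rewrite lee_fin v0.
- by apply/disj_setPS; rewrite XY0.
Qed.

(** Real-valued form of [Vm]; by [fin_num_Vm], [fine] loses nothing on pieces inside [C]. *)
Definition value v X : R := fine (Vm v X).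

Lemma value_le C v X Y : value_density C v -> piece C -> piece X -> piece Y ->
  X `<=` Y -> Y `<=` C -> value v X <= value v Y.
Proof.
move=> vC mC mX mY XY YC; apply: fine_le; last exact: (le_Vm vC).
  exact: (fin_num_Vm vC mC mX (subset_trans XY YC)).
exact: (fin_num_Vm vC).
Qed.

Lemma value_setU C v X Y : value_density C v -> piece C -> piece X -> piece Y ->
  X `<=` C -> Y `<=` C -> X `&` Y = set0 -> value v (X `|` Y) = value v X + value v Y.
Proof.
move=> vC mC mX mY XC YC XY0; rewrite /value (Vm_setU vC mC mX mY XC YC XY0).
by rewrite fineD//; exact: (fin_num_Vm vC).
Qed.

Lemma value_setU_le C v X Y : value_density C v -> piece C -> piece X -> piece Y ->
  X `<=` C -> Y `<=` C -> value v (X `|` Y) <= value v X + value v Y.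
Proof.
move=> vC mC mX mY XC YC.
have mYX : piece (Y `\` X) by exact: measurableD.
have YXC : Y `\` X `<=` C by move=> x [/YC].
have -> : X `|` Y = X `|` (Y `\` X).
  apply/seteqP; split=> x [Xx|]; [by left| |by left|by case=> ? _; right].
  by move=> Yx; have [Xx|nXx] := pselect (X x); [left|right].
rewrite (value_setU vC mC mX mYX XC YXC) ?setDIK// lerD2l.
by apply: (value_le vC) => // x [].
Qed.

(** The bound on the density turns the area of a strip into a bound on its value. The constant is
    chosen before [X], [f] and [w], which makes the later estimates uniform in the direction of the
    cut. *)
Lemma value_strip C v k K : value_density C v -> piece C -> 0 <= K ->
  C `<=` box2 k K ->
  exists2 kap : R, 0 <= kap & forall X f w, piece X -> X `<=` C -> affine2 f ->
    0 <= w -> value v (X `&` [set x | `|f x| <= w]) <= kap * w.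
Proof.
move=> vC mC K0 Cbox; have [v0 [M vM] iv _] := vC.
(* Truncating at 0 gives a non-negative bound without exhibiting a point of [C]. *)
pose M' := Num.max M 0; have M'0 : 0 <= M' by rewrite le_max lexx orbT.
exists (M' * (8 * K)) => [|X f w mX XC af w0]; first by rewrite !mulr_ge0.
set Y := X `&` _; have mY : piece Y by apply: measurableI => //; exact: piece_strip.
have YC : Y `<=` C by move=> x [/XC].
rewrite -lee_fin fineK; last exact: (fin_num_Vm vC).
apply: (@le_trans _ _ (\int[leb2 (R:=R)]_(x in Y) (cst M'%:E) x)%E).
  apply: ge0_le_integral => //.
  - by move=> x /YC Cx; rewrite lee_fin v0.
  - exact: (Vm_measurable vC).
  - by move=> x /YC Cx; rewrite lee_fin le_max vM.
rewrite integral_cst// -mulrA EFinM lee_wpmul2l ?lee_fin//.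
apply: (le_trans _ (leb2_strip k af K0 w0)); apply: le_measure; rewrite ?inE//.
  by apply: measurableI; [exact: piece_box2|exact: piece_strip].
by move=> x [/XC/Cbox].
Qed.

(* The symmetric difference of two nearby polygons lies in thin strips along
   their edges, so the value of a polygon is Lipschitz in its edges. *)
Lemma value_polygon_lipschitz C v kap : value_density C v -> piece C ->
  (forall X f w, piece X -> X `<=` C -> affine2 f ->
    0 <= w -> value v (X `&` [set x | `|f x| <= w]) <= kap * w) ->
  forall n F G w D, piece D -> D `<=` C -> 0 <= w ->
  (forall i, affine2 (F i)) -> (forall i, affine2 (G i)) ->
  (forall i x, C x -> `|F i x - G i x| <= w) ->
  value v (D `&` polygon n F) <= value v (D `&` polygon n G) + n%:R * (kap * w).
Proof.
(* [D] stays general, because the induction hypothesis is applied to [D] already cut by the last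
   edge of [G]. *)
move=> vC mC hk n F G w D + + w0 aF aG FG; elim: n D => [|n IH] D mD DC.
  by rewrite !polygon0 mul0r addr0.
have mDn : piece (D `&` polygon n F).
  by apply: measurableI => //; exact: piece_polygon.
have mDG : piece (D `&` [set x | 0 <= G n x]).
  by apply: measurableI => //; exact: piece_halfplane.
have DGC : D `&` [set x | 0 <= G n x] `<=` C by move=> x [/DC].
have DnC : D `&` polygon n F `<=` C by move=> x [/DC].
rewrite !polygonS [polygon n G `&` _]setIC !setIA.
rewrite mulrSr mulrDl mul1r.
have h1 := IH _ mDG DGC; rewrite [X in value v X <= _]setIAC in h1.
have h2 := hk _ (F n) w mDn DnC (aF n) w0.
set S := [set x | `|F n x| <= w] in h2.
(* Exchanging the last edge costs one strip: where [F n] is non-negative and [G n] negative, [F n]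
   is at most [w]. *)
suff h3 : value v (D `&` polygon n F `&` [set x | 0 <= F n x]) <=
    value v (D `&` polygon n F `&` [set x | 0 <= G n x]) + value v (D `&` polygon n F `&` S) by lra.
have mA : piece (D `&` polygon n F `&` [set x | 0 <= G n x]).
  by apply: measurableI => //; exact: piece_halfplane.
have mB : piece (D `&` polygon n F `&` S).
  by apply: measurableI => //; exact: piece_strip.
apply: (le_trans _ (value_setU_le vC mC mA mB _ _)); [|by move=> x [/DnC]..].
apply: (value_le vC mC) => //.
- by apply: measurableI => //; exact: piece_halfplane.
- exact: measurableU.
- move=> x [Dx /= Fx]; have [Gx|Gx] := leP 0 (G n x); [by left|right; split => //].
  have /DnC/(FG n) := Dx; rewrite /S/= !ler_norml; lra.
- by move=> x [] [/DnC].
Qed.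

End Polygon.

(** * The two contracted parts of [C]: disjointness, convexity, fatness, and displacement of their
    edges *)

Section Cut.
Set Implicit Arguments. Unset Strict Implicit. Unset Printing Implicit Defensive.
Context {R : realType}.
Variables (c : R * R) (p q l : R) (c2 : R * R) (L : R) (C : set (R * R)).
Hypotheses (pq : p ^+ 2 + q ^+ 2 = 1) (l0 : 0 < l) (L0 : 0 < L).
Hypotheses (cC : convex_set2 C) (lC : square c p q l `<=` C)
  (CL : C `<=` square c2 p q L).

(** Orthonormal coordinates with origin [c] and axes [(p, q)] and [(-q, p)], in which both squares
    are products of intervals; [pt] is the inverse map. *)
Definition xcoord x : R := (x.1 - c.1) * p + (x.2 - c.2) * q.
Definition ycoord x : R := (x.2 - c.2) * p - (x.1 - c.1) * q.
Definition pt (A B : R) : R * R := (c.1 + A * p - B * q, c.2 + A * q + B * p).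

Lemma xcoord_pt A B : xcoord (pt A B) = A.
Proof. by rewrite /xcoord/= -[RHS]mulr1 -pq; ring. Qed.

Lemma ycoord_pt A B : ycoord (pt A B) = B.
Proof. by rewrite /ycoord/= -[RHS]mulr1 -pq; ring. Qed.

Lemma pt_coord x : pt (xcoord x) (ycoord x) = x.
Proof.
case: x => x1 x2; rewrite /pt /xcoord /ycoord/=; congr pair.
  by rewrite -[RHS](subrKC c.1) -[X in _ = _ + X]mulr1 -pq; ring.
by rewrite -[RHS](subrKC c.2) -[X in _ = _ + X]mulr1 -pq; ring.
Qed.

Lemma squareE k r x : square k p q r x <->
  `|xcoord x - xcoord k| <= r / 2 /\ `|ycoord x - ycoord k| <= r / 2.
Proof.
rewrite /square/=.
have -> : (x.1 - k.1) * p + (x.2 - k.2) * q = xcoord x - xcoord k by rewrite /xcoord; ring.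
by have -> : (x.2 - k.2) * p - (x.1 - k.1) * q = ycoord x - ycoord k by rewrite /ycoord; ring.
Qed.

Lemma xcoord_c : xcoord c = 0. Proof. by rewrite /xcoord !subrr !mul0r addr0. Qed.
Lemma ycoord_c : ycoord c = 0. Proof. by rewrite /ycoord !subrr !mul0r subr0. Qed.

Lemma pt_in A B : `|A| <= l / 2 -> `|B| <= l / 2 -> C (pt A B).
Proof. by move=> hA hB; apply: lC; apply/squareE; rewrite xcoord_pt ycoord_pt xcoord_c ycoord_c !subr0. Qed.

Lemma in_outer x : C x -> `|xcoord x - xcoord c2| <= L / 2 /\ `|ycoord x - ycoord c2| <= L / 2.
Proof. by move=> /CL/squareE. Qed.

(** It suffices that two opposite corners of the inner square lie in the outer one. *)
Lemma outer_center : [/\ l <= L, `|xcoord c2| <= (L - l) / 2 & `|ycoord c2| <= (L - l) / 2].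
Proof.
have hl : `|l / 2| <= l / 2 by rewrite ger0_norm// divr_ge0// ltW.
have hl' : `|- (l / 2)| <= l / 2 by rewrite normrN.
have [] := in_outer (pt_in hl hl); have [] := in_outer (pt_in hl' hl').
rewrite !xcoord_pt !ycoord_pt !ler_norml => /andP[h1 h2] /andP[h3 h4] /andP[h5 h6] /andP[h7 h8].
split; [lra|apply/andP; split; lra..].
Qed.

(* The edges of the image of the half of the outer square lying in direction u
   under the contraction of ratio 1 - e towards the point c + (l / 2) u. *)
Definition edge e (u : R * R) (i : nat) x : R :=
  match i with
  | 0%N => u.1 * xcoord x + u.2 * ycoord x - e * (l / 2) * (u.1 ^+ 2 + u.2 ^+ 2)
  | 1%N => (1 - e) * (L / 2) - (xcoord x - ((1 - e) * xcoord c2 + e * (l / 2) * u.1))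
  | 2%N => (1 - e) * (L / 2) + (xcoord x - ((1 - e) * xcoord c2 + e * (l / 2) * u.1))
  | 3%N => (1 - e) * (L / 2) - (ycoord x - ((1 - e) * ycoord c2 + e * (l / 2) * u.2))
  | _ => (1 - e) * (L / 2) + (ycoord x - ((1 - e) * ycoord c2 + e * (l / 2) * u.2))
  end.

(** Directions are not normalised: the lower bound makes edge 0 an [affine2] function, and the upper
    bounds keep the centre of contraction, [c] plus [l / 2] times [u], in the inner square. *)
Definition direction (u : R * R) :=
  [/\ 2^-1 <= u.1 ^+ 2 + u.2 ^+ 2, `|u.1| <= 1 & `|u.2| <= 1].

Definition oppd (u : R * R) : R * R := (- u.1, - u.2).

Definition cut e u := C `&` polygon 5 (edge e u).

Lemma direction_opp u : direction u -> direction (oppd u).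
Proof. by case=> ? ? ?; split; rewrite /= ?sqrrN ?normrN. Qed.

Lemma affine2_edge e u i : direction u -> affine2 (edge e u i).
Proof.
case=> u2 _ _.
have aff (al be ga : R) (f : R * R -> R) : 2^-1 <= al ^+ 2 + be ^+ 2 ->
  (forall x, f x = al * x.1 + be * x.2 + ga) -> affine2 f.
  by move=> h1 h2; exists al, be, ga.
case: i => [|[|[|[|i]]]].
- apply: (aff (u.1 * p - u.2 * q) (u.1 * q + u.2 * p) (edge e u 0%N (0, 0))).
    have -> // : (u.1 * p - u.2 * q) ^+ 2 + (u.1 * q + u.2 * p) ^+ 2 =
      u.1 ^+ 2 + u.2 ^+ 2.
    by rewrite -[RHS]mulr1 -pq; ring.
  by move=> x; rewrite /edge /xcoord /ycoord/=; ring.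
- apply: (aff (- p) (- q) (edge e u 1%N (0, 0))); first by rewrite !sqrrN pq; lra.
  by move=> x; rewrite /edge /xcoord /ycoord/=; ring.
- apply: (aff p q (edge e u 2%N (0, 0))); first by rewrite pq; lra.
  by move=> x; rewrite /edge /xcoord /ycoord/=; ring.
- apply: (aff q (- p) (edge e u 3%N (0, 0))); first by rewrite sqrrN addrC pq; lra.
  by move=> x; rewrite /edge /xcoord /ycoord/=; ring.
- apply: (aff (- q) p (edge e u 4%N (0, 0))); first by rewrite sqrrN addrC pq; lra.
  by move=> x; rewrite /edge /xcoord /ycoord/=; ring.
Qed.

Lemma polygon5 (F : nat -> R * R -> R) x : (forall i, (i < 5)%N -> 0 <= F i x) <->
  [/\ 0 <= F 0%N x, 0 <= F 1%N x, 0 <= F 2%N x, 0 <= F 3%N x & 0 <= F 4%N x].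
Proof.
split=> [h|[h0 h1 h2 h3 h4] [|[|[|[|[|i]]]]]//].
by split; apply: h.
Qed.

(** The functions of edge 0 for [u] and for [oppd u] add up to a negative constant, so they are
    never both non-negative. *)
Lemma cut_disjoint e u : 0 < e -> direction u -> cut e u `&` cut e (oppd u) = set0.
Proof.
move=> e0 [u1 _ _]; apply/seteqP; split=> // x [[_ /polygon5[h _ _ _ _]] [_ /polygon5[h' _ _ _ _]]].
move: h h'; rewrite /edge/= !sqrrN => h h'.
have : 0 < e * (l / 2) * (u.1 ^+ 2 + u.2 ^+ 2) by rewrite !mulr_gt0//; lra.
by move=> ?; exfalso; lra.
Qed.

Lemma cut_sub e u : cut e u `<=` C. Proof. by move=> x []. Qed.

Lemma cut_convex e u : direction u -> convex_set2 (cut e u).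
Proof.
by move=> du; apply: convex_set2I => //; apply: convex_polygon => i; exact: affine2_edge.
Qed.

Lemma cut_piece e u : piece C -> direction u -> piece (cut e u).
Proof.
by move=> mC du; apply: measurableI => //; apply: piece_polygon => i; exact: affine2_edge.
Qed.

(* In the inner square, a line through c misses two opposite open quadrants. *)
Lemma quadrant_coord (s t : R) : let sg := (if 0 <= s then 1 else -1) in
  `|t - sg * (l / 4)| <= l / 4 -> `|t| <= l / 2 /\ 0 <= s * t.
Proof.
rewrite /=; case: ifPn => [s0|]; last rewrite -ltNge => s0.
  by rewrite !ler_norml => /andP[h1 h2]; split; [lra|rewrite mulr_ge0//; lra].
rewrite !ler_norml => /andP[h1 h2]; split; [lra|rewrite mulr_le0//; lra].
Qed.

Lemma cut_fat Rf e u : L / l <= Rf -> 0 <= e -> e < 1 -> direction u ->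
  fat (2 * Rf) (cut e u).
Proof.
move=> LR e0 e1 [_ u1 u2]; have l_gt0 := l0; have e1' : 0 < 1 - e by lra.
pose s1 : R := if 0 <= u.1 then 1 else -1; pose s2 : R := if 0 <= u.2 then 1 else -1.
(* The witnesses are the images under the contraction of a quadrant of the inner square, which has
   side [l / 2], and of the outer square. The factor [1 - e] cancels in the ratio of the sides. *)
exists (pt (e * (l / 2) * u.1 + (1 - e) * (s1 * (l / 4)))
           (e * (l / 2) * u.2 + (1 - e) * (s2 * (l / 4)))),
  (pt ((1 - e) * xcoord c2 + e * (l / 2) * u.1) ((1 - e) * ycoord c2 + e * (l / 2) * u.2)),
  p, q, ((1 - e) * (l / 2)), ((1 - e) * L); split => //.
- by split; apply: mulr_gt0 => //; rewrite divr_gt0.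
- move=> x /squareE; rewrite xcoord_pt ycoord_pt => -[hx hy].
  (* [t1] and [t2] are the coordinates of the preimage of [x] under the contraction. *)
  pose t1 := (xcoord x - e * (l / 2) * u.1) / (1 - e).
  pose t2 := (ycoord x - e * (l / 2) * u.2) / (1 - e).
  have x1E : xcoord x = (1 - e) * t1 + e * (l / 2) * u.1 by rewrite /t1; field; lra.
  have x2E : ycoord x = (1 - e) * t2 + e * (l / 2) * u.2 by rewrite /t2; field; lra.
  have [t1l t1s] : `|t1| <= l / 2 /\ 0 <= u.1 * t1.
    apply: quadrant_coord; rewrite -/s1 -(ler_pM2l e1') -[X in X * _]gtr0_norm// -normrM.
    by move: hx; rewrite x1E; congr (`|_| <= _); [ring|field].
  have [t2l t2s] : `|t2| <= l / 2 /\ 0 <= u.2 * t2.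
    apply: quadrant_coord; rewrite -/s2 -(ler_pM2l e1') -[X in X * _]gtr0_norm// -normrM.
    by move: hy; rewrite x2E; congr (`|_| <= _); [ring|field].
  have Cy := pt_in t1l t2l.
  have Cu : C (pt (l / 2 * u.1) (l / 2 * u.2)).
    by apply: pt_in; rewrite normrM gtr0_norm; nra.
  have [oy1 oy2] := in_outer Cy; rewrite xcoord_pt ycoord_pt in oy1 oy2.
  split.
    (* By construction [x] is a convex combination of its preimage and the centre of contraction,
       both of which lie in [C]. *)
    rewrite -(pt_coord x) x1E x2E.
    have -> : pt ((1 - e) * t1 + e * (l / 2) * u.1) ((1 - e) * t2 + e * (l / 2) * u.2) =
      ((1 - e) * (pt t1 t2).1 + e * (pt (l / 2 * u.1) (l / 2 * u.2)).1,
       (1 - e) * (pt t1 t2).2 + e * (pt (l / 2 * u.1) (l / 2 * u.2)).2).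
      by congr pair => /=; ring.
    by apply: cC => //; apply/andP; split => //; exact: ltW.
  move: oy1 oy2; rewrite !ler_norml => /andP[h1 h2] /andP[h3 h4].
  apply/polygon5; split; rewrite /edge/= ?x1E ?x2E.
  (* Each edge function at [x] is [1 - e] times the uncontracted one at the preimage, here and in
     the four cases below. *)
  + have -> : u.1 * ((1 - e) * t1 + e * (l / 2) * u.1) + u.2 * ((1 - e) * t2 + e * (l / 2) * u.2)
      - e * (l / 2) * (u.1 ^+ 2 + u.2 ^+ 2) = (1 - e) * (u.1 * t1 + u.2 * t2) by ring.
    by apply: mulr_ge0; [exact: ltW|exact: addr_ge0].
  + have : 0 <= L / 2 - (t1 - xcoord c2) by lra.
    by move=> /(mulr_ge0 (ltW e1')); lra.
  + have : 0 <= L / 2 + (t1 - xcoord c2) by lra.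
    by move=> /(mulr_ge0 (ltW e1')); lra.
  + have : 0 <= L / 2 - (t2 - ycoord c2) by lra.
    by move=> /(mulr_ge0 (ltW e1')); lra.
  + have : 0 <= L / 2 + (t2 - ycoord c2) by lra.
    by move=> /(mulr_ge0 (ltW e1')); lra.
- move=> x [_ /polygon5[_]]; rewrite /edge => h1 h2 h3 h4; apply/squareE.
  by rewrite xcoord_pt ycoord_pt !ler_norml; split; lra.
- rewrite (_ : _ / _ = 2 * (L / l)); last by field; lra.
  by rewrite ler_pM2l.
Qed.

(** Passing from 0 to [e] translates each edge function by [e] times a number independent of [x],
    which [outer_center] bounds. *)
Lemma edge_lip_e e u i x : C x -> 0 <= e -> direction u ->
  `|edge 0 u i x - edge e u i x| <= 2 * L * e.
Proof.
move=> Cx e0 [_ u1 u2]; have l_gt0 := l0; have [lL a2 o2] := outer_center.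
have key (D d : R) : D = e * d -> `|d| <= 2 * L -> `|D| <= 2 * L * e.
  by move=> -> h; rewrite normrM ger0_norm// mulrC ler_wpM2r.
rewrite !ler_norml in u1 u2 a2 o2.
case: i => [|[|[|[|i]]]]; rewrite /edge.
- apply: (key _ (l / 2 * (u.1 ^+ 2 + u.2 ^+ 2))); [ring|rewrite ler_norml].
  have : 0 <= u.1 ^+ 2 + u.2 ^+ 2 <= 2 by rewrite addr_ge0 ?sqr_ge0//=; nra.
  by set S := _ + _ => /andP[S0 S2]; clearbody S; nra.
- by apply: (key _ (L / 2 + xcoord c2 - l / 2 * u.1)); [ring|rewrite ler_norml; nra].
- by apply: (key _ (L / 2 - xcoord c2 + l / 2 * u.1)); [ring|rewrite ler_norml; nra].
- by apply: (key _ (L / 2 + ycoord c2 - l / 2 * u.2)); [ring|rewrite ler_norml; nra].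
- by apply: (key _ (L / 2 - ycoord c2 + l / 2 * u.2)); [ring|rewrite ler_norml; nra].
Qed.

Lemma coord_bound x : C x -> `|xcoord x| <= L /\ `|ycoord x| <= L.
Proof.
move=> Cx; have l_gt0 := l0; have [lL a2 o2] := outer_center; have [ax ox] := in_outer Cx.
rewrite !ler_norml in a2 o2 ax ox *; lra.
Qed.

Lemma edge_lip_u e u u' i x : C x -> 0 <= e -> e <= 1 -> direction u -> direction u' ->
  `|edge e u i x - edge e u' i x| <= 2 * L * (`|u.1 - u'.1| + `|u.2 - u'.2|).
Proof.
move=> Cx e0 e1 [_ u1 u2] [_ v1 v2]; have l_gt0 := l0; have [lL _ _] := outer_center.
have [ax ox] := coord_bound Cx.
have key (A B D : R) : D = (u.1 - u'.1) * A + (u.2 - u'.2) * B ->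
    `|A| <= 2 * L -> `|B| <= 2 * L ->
    `|D| <= 2 * L * (`|u.1 - u'.1| + `|u.2 - u'.2|).
  move=> -> hA hB; apply: (le_trans (ler_normD _ _)); rewrite !normrM mulrDr.
  by apply: lerD; rewrite mulrC ler_wpM2r.
have el : 0 <= e * (l / 2) <= L / 2 by apply/andP; split; [rewrite mulr_ge0//; lra|nra].
have small (t s : R) : `|t| <= L -> `|s| <= 2 -> `|t - e * (l / 2) * s| <= 2 * L.
  move: el; set el := e * (l / 2); clearbody el; rewrite !ler_norml.
  by nra.
have sum2 (s t : R) : `|s| <= 1 -> `|t| <= 1 -> `|s + t| <= 2 by rewrite !ler_norml; lra.
have elL : `|e * (l / 2)| <= 2 * L by rewrite ler_norml; lra.
have z0 : `|0 : R| <= 2 * L by rewrite normr0; lra.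
case: i => [|[|[|[|i]]]]; rewrite /edge.
(* The term quadratic in the direction is factored as a difference of squares. *)
- apply: (key (xcoord x - e * (l / 2) * (u.1 + u'.1)) (ycoord x - e * (l / 2) * (u.2 + u'.2))).
  + ring.
  + exact: small _ _ ax (sum2 _ _ u1 v1).
  + exact: small _ _ ox (sum2 _ _ u2 v2).
- by apply: (key (e * (l / 2)) 0) => //; ring.
- by apply: (key (- (e * (l / 2))) 0) => //; [ring|rewrite normrN].
- by apply: (key 0 (e * (l / 2))) => //; ring.
- by apply: (key 0 (- (e * (l / 2)))) => //; [ring|rewrite normrN].
Qed.

(** Without contraction the last four edges are those of the outer square, which contains [C]; only
    the two closed half-planes remain, and they cover the plane. *)
Lemma cut0_cover u : cut 0 u `|` cut 0 (oppd u) = C.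
Proof.
apply/seteqP; split=> [x [[]|[]]//|x Cx].
have [] := in_outer Cx; rewrite !ler_norml => /andP[h1 h2] /andP[h3 h4].
have [h|h] := leP 0 (u.1 * xcoord x + u.2 * ycoord x).
  by left; split => //; apply/polygon5; rewrite /edge; split; lra.
by right; split => //; apply/polygon5; rewrite /edge/=; split; lra.
Qed.

(** The strip bound needs a box parallel to the axes of the plane, whatever the direction of the
    squares. *)
Lemma sub_box2 : C `<=` box2 c (2 * L).
Proof.
move=> x Cx; have [ax ox] := coord_bound Cx; rewrite -(pt_coord x) /box2 /pt/=.
have [p1 q1] : `|p| <= 1 /\ `|q| <= 1.
  by have := pq; rewrite !ler_norml; split; apply/andP; split; nra.
have key (A B s t : R) : `|A| <= L -> `|B| <= L -> `|s| <= 1 -> `|t| <= 1 ->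
    `|A * s + B * t| <= 2 * L.
  move=> hA hB hs ht; apply: (le_trans (ler_normD _ _)); rewrite !normrM.
  by have := ler_pM (normr_ge0 A) (normr_ge0 s) hA hs;
    have := ler_pM (normr_ge0 B) (normr_ge0 t) hB ht; lra.
split.
  rewrite (_ : _ - c.1 = xcoord x * p + ycoord x * (- q)); last by ring.
  by apply: key; rewrite ?normrN.
rewrite (_ : _ - c.2 = xcoord x * q + ycoord x * p); last by ring.
exact: key.
Qed.

(** Gives [C] positive area, so that the constant density 1 is admissible. *)
Lemma box2_sub : box2 c (l / 4) `<=` C.
Proof.
move=> x [hx hy]; have l_gt0 := l0; apply: lC; apply/squareE; rewrite xcoord_c ycoord_c !subr0.
have [p1 q1] : `|p| <= 1 /\ `|q| <= 1.
  by have := pq; rewrite !ler_norml; split; apply/andP; split; nra.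
have key (A B s t : R) : `|A| <= l / 4 -> `|B| <= l / 4 -> `|s| <= 1 -> `|t| <= 1 ->
    `|A * s + B * t| <= l / 2.
  move=> hA hB hs ht; apply: (le_trans (ler_normD _ _)); rewrite !normrM.
  by have := ler_pM (normr_ge0 A) (normr_ge0 s) hA hs;
    have := ler_pM (normr_ge0 B) (normr_ge0 t) hB ht; lra.
by rewrite /ycoord -mulrN; split; apply: key; rewrite ?normrN.
Qed.

End Cut.

(** * Values and envy-freeness for pieces in the family, and the uniform density *)

Section Division.
Set Implicit Arguments. Unset Strict Implicit. Unset Printing Implicit Defensive.
Context {R : realType}.
Implicit Types (S : set (set (R * R))) (X C : set (R * R)) (v : R * R -> R).

Lemma lipschitz_within_continuous (f : R -> R) (a b K : R) :
  (forall s t, s \in `[a, b] -> t \in `[a, b] -> `|f s - f t| <= K * `|s - t|) ->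
  {within `[a, b], continuous f}.
Proof.
move=> fK; pose K' := Num.max K 1; have K'0 : 0 < K' by rewrite lt_max ltr01 orbT.
apply/subspace_continuousP => x /= xab; apply/cvgrPdist_le => e e0.
rewrite near_withinE; near=> y => /= yab.
apply: (le_trans (fK _ _ xab yab)); apply: (@le_trans _ _ (K' * `|x - y|)).
  by rewrite ler_wpM2r// le_max lexx.
rewrite mulrC -ler_pdivlMr//; near: y.
by apply: cvgr_dist_le; [exact: cvg_id|rewrite divr_gt0].
Unshelve. all: by end_near. Qed.

(** The supremum is attained at [X] itself, so between members of [S] envy is a comparison of plain
    values. *)
Lemma VS_mem S C v X : (forall s, S s -> piece s) -> value_density C v -> piece C ->
  S X -> X `<=` C -> VS S v X = Vm v X.
Proof.
move=> mS vC mC SX XC; apply/eqP; rewrite eq_le; apply/andP; split.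
  by apply: ge_ereal_sup => _ [s [Ss sX] <-]; apply: (le_Vm vC mC) => //; exact: mS.
by apply: ereal_sup_ubound; exists X => //; split => //; exact: subset_refl.
Qed.

Lemma VS_le_value S C v X Y : (forall s, S s -> piece s) -> value_density C v -> piece C ->
  S X -> S Y -> X `<=` C -> Y `<=` C ->
  (VS S v X <= VS S v Y)%E = (value v X <= value v Y).
Proof.
move=> mS vC mC SX SY XC YC; rewrite !(VS_mem mS vC)//.
rewrite -[Vm v X]fineK ?lee_fin; last by apply: (fin_num_Vm vC) => //; exact: mS.
by rewrite -[Vm v Y]fineK ?lee_fin; last by apply: (fin_num_Vm vC) => //; exact: mS.
Qed.

Lemma value_gt0 C v : value_density C v -> piece C -> 0 < value v C.
Proof.
move=> vC mC; case: (vC) => _ _ _ V0; rewrite -lte_fin fineK//.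
exact: (fin_num_Vm vC).
Qed.

Lemma prop_value2 C (v : 'I_2 -> R * R -> R) (X : 'I_2 -> set (R * R)) :
  prop_value C v X = (Num.min (value (v 0) (X 0) / value (v 0) C)
                             (value (v 1) (X 1) / value (v 1) C))%:E.
Proof.
rewrite /prop_value big_ord_recl big_ord_recl big_ord0.
rewrite (_ : lift ord0 ord0 = 1); last exact/val_inj.
by rewrite miney -EFin_min.
Qed.

Lemma Vm_cst1 C : piece C -> Vm (cst 1) C = leb2 C.
Proof.
move=> mC; apply: (@eq_trans _ _ (\int[leb2 (R:=R)]_(x in C) (cst 1%:E) x)%E) => //.
by rewrite integral_cst// mul1e.
Qed.

Lemma value_density_cst1 C k K r : piece C -> 0 < K -> C `<=` box2 k K ->
  0 < r -> box2 k r `<=` C -> value_density C (cst 1).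
Proof.
move=> mC K0 CK r0 rC.
have finC : (leb2 C < +oo)%E.
  apply: (@le_lt_trans _ _ (leb2 (box2 k K))); last by rewrite leb2_box2// ltry.
  by apply: le_measure => //; rewrite inE//; exact: piece_box2.
split => [x _|||].
- exact: ler01.
- by exists 1.
- apply/integrableP; split; first exact: (measurable_cst (1%:E : \bar R)).
  rewrite [ltLHS](_ : _ = leb2 C)// -[RHS](Vm_cst1 mC).
  by apply: eq_integral => x _; rewrite /= normr1.
- rewrite Vm_cst1//; apply: (@lt_le_trans _ _ (leb2 (box2 k r))).
    by rewrite leb2_box2// lte_fin mulr_gt0// exprn_gt0.
  by apply: le_measure => //; rewrite inE//; exact: piece_box2.
Qed.

End Division.

(** * Loss of value under contraction, and exact halving for one agent *)

Section Halving.
Set Implicit Arguments. Unset Strict Implicit. Unset Printing Implicit Defensive.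
Context {R : realType}.
Variables (c : R * R) (p q l : R) (c2 : R * R) (L : R) (C : set (R * R)).
Hypotheses (pq : p ^+ 2 + q ^+ 2 = 1) (l0 : 0 < l) (L0 : 0 < L).
Hypotheses (cC : convex_set2 C) (lC : square c p q l `<=` C)
  (CL : C `<=` square c2 p q L) (mC : piece C).

Local Notation cut := (cut c p q l c2 L C).

Let strip v (vC : value_density C v) :=
  value_strip vC mC (ltW (mulr_gt0 (ltr0Sn R 1) L0)) (sub_box2 pq l0 lC CL).

Lemma cut_value_lower v : value_density C v -> exists2 kap, 0 <= kap &
  forall e u, 0 <= e -> direction u ->
    value v C <= value v (cut e u) + value v (cut e (oppd u)) + kap * e.
Proof.
move=> vC; have [kap kap0 hk] := strip vC.
exists (20 * kap * L) => [|e u e0 du]; first by rewrite !mulr_ge0// ltW.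
have Le0 : 0 <= 2 * L * e by rewrite !mulr_ge0// ltW.
have side w : direction w ->
    value v (cut 0 w) <= value v (cut e w) + 5 * (kap * (2 * L * e)).
  move=> dw; apply: (value_polygon_lipschitz vC mC hk) => //.
  - by move=> i; exact: affine2_edge.
  - by move=> i; exact: affine2_edge.
  - by move=> i x Cx; exact: (edge_lip_e pq l0 lC CL).
have := side _ du; have := side _ (direction_opp du).
have mcut w : direction w -> piece (cut 0 w) by exact: cut_piece.
have := value_setU_le vC mC (mcut _ du) (mcut _ (direction_opp du)) (@cut_sub _ _ _ _ _ _ _ _ _ _)
  (@cut_sub _ _ _ _ _ _ _ _ _ _).
rewrite cut0_cover//; lra.
Qed.

(* Avoids trigonometry: any path between two opposite directions will do. *)
Definition dirpath (t : R) : R * R := (t, 1 - `|t|).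

Lemma direction_dirpath t : t \in `[-1, 1] -> direction (dirpath t).
Proof.
rewrite in_itv/= -ler_norml => t1; split => //=.
  (* The sum of the squares of [|t|] and [1 - |t|] exceeds 1/2 by twice this square. *)
  rewrite -(real_normK (num_real t)); have := sqr_ge0 (`|t| - 2^-1).
  by rewrite !expr2; lra.
have n0 := normr_ge0 t; by rewrite ger0_norm; lra.
Qed.

Lemma cut_value_lipschitz v e : value_density C v -> 0 <= e -> e <= 1 ->
  exists2 kap, 0 <= kap & forall u w d, direction u -> direction w ->
    `|u.1 - w.1| <= d -> `|u.2 - w.2| <= d ->
    `|value v (cut e u) - value v (cut e w)| <= kap * d.
Proof.
move=> vC e0 e1; have [kap kap0 hk] := strip vC.
(* Five edges, each moving by at most [2 * L * (d + d)]. *)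
exists (5 * (kap * (4 * L))) => [|u w d du dw]; first by rewrite !mulr_ge0// ltW.
have side u' w' : direction u' -> direction w' ->
    `|u'.1 - w'.1| <= d -> `|u'.2 - w'.2| <= d ->
    value v (cut e u') <= value v (cut e w') + 5 * (kap * (4 * L)) * d.
  move=> du' dw' h1 h2; rewrite -(mulrA 5) -(mulrA kap).
  have d0 := le_trans (normr_ge0 _) h1.
  apply: (value_polygon_lipschitz vC mC hk) => //.
  - by rewrite !mulr_ge0// ltW.
  - by move=> i; exact: affine2_edge.
  - by move=> i; exact: affine2_edge.
  - move=> i x Cx; apply: (le_trans (edge_lip_u pq l0 lC CL _ Cx e0 e1 du' dw')).
    rewrite (_ : 4 * L * d = 2 * L * (d + d)); last by ring.
    by rewrite ler_wpM2l ?lerD// mulr_ge0// ltW.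
move=> h1 h2; have s1 := side _ _ du dw h1 h2.
rewrite distrC in h1; rewrite distrC in h2; have s2 := side _ _ dw du h1 h2.
move: s1 s2; set a := value v _; set b := value v _; set r := _ * d.
by rewrite ler_norml => s1 s2; apply/andP; split; lra.
Qed.

Lemma cut_halving v e : value_density C v -> 0 < e -> e < 1 ->
  exists2 u, direction u & value v (cut e u) = value v (cut e (oppd u)).
Proof.
move=> vC e0 e1; have [kap kap0 lip] := cut_value_lipschitz vC (ltW e0) (ltW e1).
pose g t := value v (cut e (dirpath t)) - value v (cut e (oppd (dirpath t))).
have gc : {within `[-1, 1], continuous g}.
  apply: (@lipschitz_within_continuous _ _ _ _ (2 * kap)) => s t s1 t1.
  have /direction_dirpath ds := s1; have /direction_dirpath dt := t1.
  have st : `|(dirpath s).2 - (dirpath t).2| <= `|s - t|.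
    rewrite /= (_ : 1 - `|s| - (1 - `|t|) = - (`|s| - `|t|)); last by ring.
    by rewrite normrN; exact: ler_dist_dist.
  have h1 := lip _ _ _ ds dt (lexx _) st.
  have h2 := lip _ _ `|s - t| (direction_opp ds) (direction_opp dt).
  rewrite /oppd/= -!opprD !normrN in h2.
  have {}h2 := h2 (lexx _) st.
  rewrite (_ : g s - g t = (value v (cut e (dirpath s)) - value v (cut e (dirpath t))) -
    (value v (cut e (oppd (dirpath s))) - value v (cut e (oppd (dirpath t))))).
    apply: (le_trans (ler_normB _ _)); rewrite -mulrA mulr_natl mulr2n.
    exact: lerD.
  by rewrite /g; ring.
(* The endpoints of the path are opposite directions, so reaching the other end swaps the two parts
   and [g] changes sign. *)
have oppg : g (-1) = - g 1.
  rewrite /g /dirpath /oppd/= normrN normr1 subrr oppr0 opprK opprB//.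
have [||t t1 gt] := @IVT _ g (-1) 1 0 _ gc.
- lra.
- rewrite oppg ge_min le_max; case: (leP 0 (g 1)) => h; last first.
    by apply/andP; split; apply/orP; [right|left]; lra.
  by apply/andP; split; apply/orP; [left|right]; lra.
by exists (dirpath t); [exact: direction_dirpath|apply/eqP; rewrite -subr_eq0 -/(g t) gt].
Qed.

(** Cut and choose: reversing the direction swaps the parts and preserves the equality for [v], so
    the part preferred by [w] can be taken on the side of [oppd u]. *)
Lemma cut_agents v w e : value_density C v -> 0 < e -> e < 1 ->
  exists u, [/\ direction u, value v (cut e u) = value v (cut e (oppd u)) &
    value w (cut e u) <= value w (cut e (oppd u))].
Proof.
move=> vC e0 e1; have [u du hu] := cut_halving vC e0 e1.
have [h|h] := leP (value w (cut e u)) (value w (cut e (oppd u))); first by exists u.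
exists (oppd u); have -> : oppd (oppd u) = u by case: (u) => a b; rewrite /oppd/= !opprK.
by split => //; [exact: direction_opp|exact: ltW].
Qed.

End Halving.

(** * The two inequalities for the proportionality constant *)

Lemma ord2P (i : 'I_2) : i = 0 \/ i = 1.
Proof. by case: i => -[|[|//]] ?; [left|right]; exact/val_inj. Qed.

Theorem mainTheorem19 (R : realType) (Rf : R) (C : set (R * R)) :
  1 <= Rf ->
  compact C -> convex_set2 C -> piece C -> fat Rf C ->
  PropEF C 2 [set X | piece X /\ convex_set2 X /\ fat (2 * Rf) X]
    = (2^-1)%:E.
Proof.
move=> _ _ cC mC [c [c2 [p [q [l [L [pq [l0 L0] lC CL LR]]]]]]].
set S := [set X | _]; have mS s : S s -> piece s by case.
apply/eqP; rewrite eq_le; apply/andP; split.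
  (* Upper bound: both agents have the uniform density, and two disjoint pieces cannot both exceed
     half of the total. *)
  have vC : value_density C (cst 1).
    apply: (value_density_cst1 mC _ (sub_box2 pq l0 lC CL) _ (box2_sub pq l0 lC)).
      by rewrite mulr_gt0.
    by rewrite divr_gt0.
  apply: (@le_trans _ _ (ereal_sup [set prop_value C (fun=> cst 1) X | X in
      [set X : 'I_2 -> _ | allocation C S X /\ envy_free S (fun=> cst 1) X]])).
    by apply: ereal_inf_lbound; exists (fun=> cst 1).
  apply: ge_ereal_sup => _ [X [[SX dX XC] _] <-]; rewrite prop_value2 lee_fin.
  have V0 := value_gt0 vC mC.
  have /(value_le vC mC) : X 0 `|` X 1 `<=` C by move=> x [/XC|/XC].
  move=> /(_ (measurableU _ _ (mS _ (SX 0)) (mS _ (SX 1))) mC (@subset_refl _ _)).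
  rewrite (value_setU vC mC (mS _ (SX 0)) (mS _ (SX 1)) (XC 0) (XC 1)); last exact: dX.
  by rewrite ge_min !ler_pdivrMr// => h; case: (leP (value (cst 1) (X 0)) (2^-1 * value (cst 1) C)) => //= ?; lra.
(* Lower bound: for arbitrary densities, 1/2 is approached up to any [d > 0]. *)
apply: le_ereal_inf_tmp => _ [v vC <-].
have [k0 k0_ge0 hk0] := cut_value_lower pq l0 L0 lC CL mC (vC 0).
have [k1 k1_ge0 hk1] := cut_value_lower pq l0 L0 lC CL mC (vC 1).
have V0 := value_gt0 (vC 0) mC; have V1 := value_gt0 (vC 1) mC.
apply/lee_addgt0Pr => d d0.
(* The loss [k * e] must be at most [2 * d] times the total of each agent, whose part is worth at
   least half of what is left. Adding 1 to [k0] and [k1] keeps the denominators positive. *)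
pose e := Num.min 2^-1 (Num.min (2 * d * value (v 0) C / (k0 + 1)) (2 * d * value (v 1) C / (k1 + 1))).
have e0 : 0 < e by rewrite !lt_min invr_gt0 ltr0n/= !divr_gt0 ?mulr_gt0 ?ltr_wpDl.
have e1 : e < 1 by rewrite gt_min; apply/orP; left; lra.
have ek0 : k0 * e <= 2 * d * value (v 0) C.
  apply: (@le_trans _ _ ((k0 + 1) * e)); first by rewrite ler_wpM2r ?ltW// ltrDl.
  by rewrite mulrC -ler_pdivlMr ?ltr_wpDl// !ge_min lexx orbT.
have ek1 : k1 * e <= 2 * d * value (v 1) C.
  apply: (@le_trans _ _ ((k1 + 1) * e)); first by rewrite ler_wpM2r ?ltW// ltrDl.
  by rewrite mulrC -ler_pdivlMr ?ltr_wpDl// !ge_min lexx !orbT.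
have [u [du h0 h1]] := cut_agents pq l0 L0 lC CL mC (v 1) (vC 0) e0 e1.
pose cu w := cut c p q l c2 L C e w.
have Scu w : direction w -> S (cu w).
  by move=> dw; split; [exact: cut_piece|split; [exact: cut_convex|exact: cut_fat (ltW e0) e1 dw]].
have cuC w : cu w `<=` C by exact: cut_sub.
(* Agent 0 is indifferent between the parts, and agent 1 receives one that is worth at least as much
   to it as the other. *)
pose X (i : 'I_2) := if i == 0 then cu u else cu (oppd u).
have du' := direction_opp du.
have XE : [/\ allocation C S X & envy_free S v X].
  split; first split.
  - by move=> i; rewrite /X; case: ifP => _; exact: Scu.
  - have dj : cu u `&` cu (oppd u) = set0 by exact: cut_disjoint.
    by move=> i j; case: (ord2P i) => ->; case: (ord2P j) => -> //= _; rewrite setIC.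
  - by move=> i; rewrite /X; case: ifP.
  - move=> i j.
    have SX m : S (X m) by rewrite /X; case: ifP => _; exact: Scu.
    have XC m : X m `<=` C by rewrite /X; case: ifP.
    rewrite (VS_le_value mS (vC i) mC (SX j) (SX i) (XC j) (XC i)).
    by case: (ord2P i) => ->; case: (ord2P j) => -> //=; rewrite /X/= -/(cu u) h0.
apply: (@le_trans _ _ (prop_value C v X + d%:E)%E); last first.
  by rewrite leeD2r//; apply: ereal_sup_ubound; exists X => //; case: XE.
rewrite prop_value2 -EFinD lee_fin -lerBlDr le_min !ler_pdivlMr//.
have := hk0 e u (ltW e0) du; have := hk1 e u (ltW e0) du.
rewrite /X/= -/(cu u) -/(cu (oppd u)) in h0 h1 *.
move=> a1 a0; apply/andP; split; lra.
Qed.
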